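(* Let $\Gamma$, the data $P,Q,R,\gamma,k_j^{-1},d_j,\lambda_{ab}$, the involution $\sigma$, the $1$-form $\Omega$ and the associated Baker--Akhiezer section $\psi(u,\cdot)$, $u=(u^1,\dots,u^n)$ in a domain of $\mathbb R^n$, be as described in the context. Suppose that there is an antiholomorphic involution $\tau:\Gamma\to\Gamma$ with $\tau(\Gamma_j)=\Gamma_{\tau(j)}$ (with $\tau$ also denoting the induced permutation of indices) such that $$\tau(Q_j)=Q_j,\quad \tau(P_j)=P_j,\quad \tau(k_j^{-1})=\overline{k_j^{-1}}\ \ (\text{i.e. } k_j^{-1}\circ\tau=\overline{k_j^{-1}}\text{ near }P_j),\quad \tau^*(\Omega)=\overline{\Omega},$$ $$\tau(\gamma)=\gamma,\quad \tau(R)=R\quad\text{(as divisors)}.$$ Suppose further that, writing $\tau(R_j)=R_{\tau(j)}$, the normalization constants in $$\psi(R_j)=d_j,\qquad \psi(\tau(R_j))=d_{\tau(j)}$$ satisfy $\overline{d_j}=d_{\tau(j)}$, and that at each intersection point of the components, given by $a\in\Gamma_p$ identified with $b\in\Gamma_q$, the gluing constants $\lambda=\lambda_{ab}$, $\lambda_\tau=\lambda_{\tau(a)\tau(b)}$ in $$\psi_p(a)=\lambda\,\psi_q(b),\qquad \psi_{\tau(p)}(\tau(a))=\lambda_\tau\,\psi_{\tau(q)}(\tau(b))$$ satisfy $\overline{\lambda}=\lambda_\tau$. Then $$\psi(u,P)=\overline{\psi(u,\tau(P))}$$ for all points $P$ of the curve; in particular, the functions $x^j(u)=\psi(u,Q_j)$,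 $j=1,\dots,n$, are real-valued.
   Context: **Spectral curve.** $\Gamma$ is a compact reducible complex curve which is a union of irreducible nonsingular components $\Gamma_1,\dots,\Gamma_m$ (compact Riemann surfaces) intersecting only at double points: each intersection point is obtained by identifying one point $a\in\Gamma_p$ with one point $b\in\Gamma_q$, $p\ne q$. The normalization $\Gamma_{\mathrm{nm}}$ is the disjoint union of the $\Gamma_j$. If $N$ is the number of intersection points, the arithmetic genus is $g_a=\sum_j g(\Gamma_j)+N-m+1$. Divisors and residues are computed on $\Gamma_{\mathrm{nm}}$; involutions of $\Gamma$ are regarded as acting on $\Gamma_{\mathrm{nm}}$. **Data.** $P=P_1+\dots+P_n$, $Q=Q_1+\dots+Q_n$, $R=R_1+\dots+R_l$, $\gamma=\gamma_1+\dots+\gamma_{g_a+l-1}$ are divisors of pairwise distinct nonsingular points of $\Gamma$ (i.e. not intersection points); $k_j^{-1}$ is a local parameter near $P_j$ (vanishing at $P_j$); $d_1,\dots,d_l\in\mathbb C$ are constants, not all $0$. For each intersection point ($a\in\Gamma_p$ identified with $b\in\Gamma_q$) a non-zero gluing constant $\lambda_{ab}\in\mathbb C$ is given, with $\lambda_{ba}=\lambda_{ab}^{-1}$. **Baker--Akhiezer section.** For $u=(u^1,\dots,u^n)$ in a domain of $\mathbb R^n$, $\psi(u,\cdot)$ is a collection of functions $\psi_j(u,\cdot)$ on the components $\Gamma_j$ such that: 1. near $P_j$, $\psi=e^{k_ju^j}\left(h_j(u)+\frac{\xi_j(u)}{k_j}+\dots\right)$, i.e. $e^{-k_ju^j}\psi$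 extends holomorphically across $P_j$; 2. away from the points $P_1,\dots,P_n$, $\psi$ is meromorphic with at most simple poles, located at the points of $\gamma$; 3. $\psi(u,R_j)=d_j$, $j=1,\dots,l$; 4. at each intersection point ($a\in\Gamma_p$ identified with $b\in\Gamma_q$), $\psi_p(u,a)=\lambda_{ab}\,\psi_q(u,b)$. Standing assumption: for every $u$ in the domain there is exactly one $\psi(u,\cdot)$ with these properties, and it depends smoothly on $u$. **Involution $\sigma$ and form $\Omega$.** $\sigma:\Gamma\to\Gamma$ is a holomorphic involution with $\sigma(\Gamma_s)=\Gamma_{\sigma(s)}$, fixing all $P_j$ and $Q_j$, with $k_j\circ\sigma=-k_j$ near $P_j$. $\Omega$ is a meromorphic $1$-form on $\Gamma$, given by meromorphic $1$-forms $\Omega_j$ on $\Gamma_j$, with divisor of zeros $P_1+\dots+P_n+\gamma+\sigma\gamma$; away from intersection points its divisor of poles is $Q_1+\dots+Q_n+R+\sigma R$; at the intersection points the $\Omega_j$ have at most simple poles, and with $\lambda=\lambda_{ab}$, $\lambda_\sigma=\lambda_{\sigma(a)\sigma(b)}$, $$\lambda\lambda_\sigma\operatorname{Res}_a\Omega_p+\operatorname{Res}_b\Omega_q=0,\qquad \lambda\lambda_\sigma\operatorname{Res}_{\sigma(a)}\Omega_{\sigma(p)}+\operatorname{Res}_{\sigma(b)}\Omega_{\sigma(q)}=0$$ at each intersection point ($a\in\Gamma_p$ identified with $b\in\Gamma_q$); and $\operatorname{Res}_{Q_1}\Omega=\dots=\operatorname{Res}_{Q_n}\Omega=1$. *)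

(* Defs.v *)
(* MathComp / MathComp-Analysis, over an abstract R : realType and the complex
   numbers R[i]. *)
From HB Require Import structures.
From mathcomp Require Import all_boot all_order all_algebra.
From mathcomp Require Import complex.
From mathcomp Require Import all_classical all_reals all_analysis.

Set Implicit Arguments.
Unset Strict Implicit.
Unset Printing Implicit Defensive.

Import Order.TTheory GRing.Theory Num.Theory.
Import numFieldNormedType.Exports.

Local Open Scope classical_set_scope.
Local Open Scope ring_scope.
Local Open Scope complex_scope.

Definition cexp (R : realType) (z : R[i]) : R[i] :=
  (expR (complex.Re z))%:C * (cos (complex.Im z) +i* sin (complex.Im z)).

(* The analytic notions are stated over any K : numFieldType, so as to use the
   library's topology on K; they are meant for, and only used with,
   K := R[i]. *)
Definition holo_near (K : numFieldType) (f : K -> K) (z : K) : Prop :=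
  \forall w \near z, derivable f w 1.

Definition cderive (K : numFieldType) (f : K -> K) (z : K) : K := derive1 f z.

(* [cfun] is only meaningful on [cdom], and [cinv] only on [cfun @` cdom]. *)
Record chart (K : numFieldType) (T : Type) := Chart {
  cdom : set T;
  cfun :> T -> K;
  cinv : K -> T }.

Record charted (K : numFieldType) := Charted {
  points :> topologicalType;
  atlas : set (chart K points) }.

Definition riemann_surface (K : numFieldType) (X : charted K) : Prop :=
  [/\ hausdorff_space X,
      forall x : X, exists2 c, atlas c & cdom c x,
      forall c : chart K X, atlas c ->
        [/\ open (cdom c), open (c @` cdom c),
            forall x, cdom c x -> cinv c (c x) = x,
            forall x, cdom c x -> {for x, continuous c} &
            forall x, cdom c x -> {for c x, continuous (cinv c)}] &
      forall (c c' : chart K X) (x : X), atlas c -> atlas c' ->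
        cdom c x -> cdom c' x -> holo_near (c' \o cinv c) (c x)].

Definition compact_connected_riemann_surface (K : numFieldType)
    (X : charted K) : Prop :=
  [/\ riemann_surface X, [set: X] !=set0, compact [set: X] &
      connected [set: X]].

Definition sum_chart (K : numFieldType) (m : nat) (X : 'I_m -> charted K)
    (j : 'I_m) (c : chart K (X j)) : chart K {j : 'I_m & X j} :=
  @Chart K {j : 'I_m & X j} (existT _ j @` cdom c) (untag 0 c)
    (existT _ j \o cinv c).

Definition disjoint_sum (K : numFieldType) (m : nat) (X : 'I_m -> charted K) :
    charted K :=
  @Charted K {j : 'I_m & X j}
    [set c | exists j (c0 : chart K (X j)), atlas c0 /\ c = sum_chart c0].

Section Local.
Variables (K : numFieldType) (X : charted K).

Definition holo_at (f : X -> K) (x : X) : Prop :=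
  forall c, atlas c -> cdom c x -> holo_near (f \o cinv c) (c x).

Definition local_parameter (t : X -> K) (x : X) : Prop :=
  [/\ holo_at t x, t x = 0 &
      forall c, atlas c -> cdom c x -> cderive (t \o cinv c) (c x) != 0].

(* Meromorphic functions take values in [option K], the Riemann sphere:
   [None] is the point at infinity, the value at the poles. *)
Definition regular_at (f : X -> option K) (x : X) : Prop :=
  exists2 g : X -> K, holo_at g x & \forall y \near x, f y = Some (g y).

(* f = t ^ k * g for a local parameter t and g holomorphic with g x != 0. *)
Definition has_order (f : X -> option K) (x : X) (k : int) : Prop :=
  exists (t g : X -> K),
    [/\ local_parameter t x, holo_at g x, g x != 0,
        \forall y \near x^', f y = Some (t y ^ k * g y) &
        f x = if k < 0 then None else Some (t x ^ k * g x)].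

Definition holomorphic_map (F : X -> X) : Prop :=
  forall (x : X) (c c' : chart K X), atlas c -> atlas c' ->
    cdom c x -> cdom c' (F x) ->
    (\forall w \near c x, cdom c' (F (cinv c w))) /\
    holo_near (c' \o F \o cinv c) (c x).

(* A 1-form w is given by its coefficients: w = (w c) dc on [cdom c]. *)
Definition one_form := chart K X -> X -> option K.

Definition form_law (w : one_form) : Prop :=
  forall (c c' : chart K X) (x : X), atlas c -> atlas c' ->
    cdom c x -> cdom c' x ->
    w c x = omap (fun v => v * cderive (c' \o cinv c) (c x)) (w c' x).

Definition form_order (w : one_form) (x : X) (k : int) : Prop :=
  forall c, atlas c -> cdom c x -> has_order (w c) x k.

(* As the order exists everywhere, w vanishes identically on no component. *)
Definition nonzero_meromorphic_form (w : one_form) : Prop :=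
  form_law w /\ forall x, exists k, form_order w x k.

(* The coefficient of (c - c x)^-1 in the Laurent expansion of w c. *)
Definition residue (w : one_form) (x : X) : K :=
  xget 0 [set r | forall c, atlas c -> cdom c x ->
    exists (N : nat) (a : nat -> K) (h : X -> K),
      holo_at h x /\
      \forall y \near x^', w c y =
        Some (r * (c y - c x)^-1
              + (\sum_(i < N) a i * (c y - c x) ^- i.+2) + h y)].

Definition holomorphic_form (w : chart K X -> X -> K) : Prop :=
  form_law (fun c x => Some (w c x)) /\
  forall c x, atlas c -> cdom c x -> holo_at (w c) x.

(* The dimension of the space of holomorphic 1-forms, which is finite on a
   compact Riemann surface. *)
Definition genus : nat :=
  xget 0%N [set g | exists b : 'I_g -> chart K X -> X -> K,
    (forall i, holomorphic_form (b i)) /\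
    forall w, holomorphic_form w ->
      exists! a : 'rV[K]_g, forall c x, atlas c -> cdom c x ->
        w c x = \sum_i a ord0 i * b i c x].

End Local.

Section Antiholomorphic.
Variables (R : realType) (X : charted R[i]).

Definition antiholomorphic_map (F : X -> X) : Prop :=
  forall (x : X) (c c' : chart R[i] X), atlas c -> atlas c' ->
    cdom c x -> cdom c' (F x) ->
    (\forall w \near c x, cdom c' (F (cinv c w))) /\
    holo_near (conjc \o c' \o F \o cinv c) (c x).

(* F^* w = conj w: for F antiholomorphic and w = f dc' near F x, the pullback
   of w is (f o F) (d(c' o F)/d(conj c)) d(conj c), and
   d(c' o F)/d(conj c) = conj (d(conj o c' o F)/dc). *)
Definition antiholomorphic_pullback_is_conj (F : X -> X) (w : one_form X) :
    Prop :=
  forall (x : X) (c c' : chart R[i] X), atlas c -> atlas c' ->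
    cdom c x -> cdom c' (F x) ->
    omap (fun v => v * conjc (cderive (conjc \o c' \o F \o cinv c) (c x)))
         (w c' (F x))
    = omap conjc (w c x).

End Antiholomorphic.

(* A nodal curve, given by its components and by the pairs of points of the
   normalization which are identified. *)
Record spectral_curve (R : realType) := SpectralCurve {
  ncomp : nat;
  component : 'I_ncomp -> charted R[i];
  componentP : forall j, compact_connected_riemann_surface (component j);
  nnode : nat;
  node1 : 'I_nnode -> disjoint_sum component;
  node2 : 'I_nnode -> disjoint_sum component;
  node_tag : forall k, tag (node1 k) != tag (node2 k);
  node_uniq : uniq (codom node1 ++ codom node2) }.
Arguments component {R} _ _.
Arguments node1 {R} _ _.
Arguments node2 {R} _ _.

Definition normalization (R : realType) (G : spectral_curve R) :
    charted R[i] :=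
  disjoint_sum (component G).

Definition arithmetic_genus (R : realType) (G : spectral_curve R) : int :=
  (\sum_(j < ncomp G) genus (component G j))%:Z + (nnode G)%:Z - (ncomp G)%:Z + 1.

Section Curve.
Variables (R : realType) (G : spectral_curve R).
Local Notation X := (normalization G).

Definition is_node (x : X) : bool :=
  x \in codom (node1 G) ++ codom (node2 G).

Definition glued (a b : X) : Prop :=
  exists k, (a = node1 G k /\ b = node2 G k) \/ (a = node2 G k /\ b = node1 G k).

(* The combinatorial part of an involution of the curve, acting on the
   normalization: it permutes the components and descends to the curve. *)
Definition curve_involution (f : X -> X) : Prop :=
  [/\ involutive f,
      exists s : 'I_(ncomp G) -> 'I_(ncomp G), forall x, tag (f x) = s (tag x) &
      forall a b, glued a b -> glued (f a) (f b)].

End Curve.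

(* [kinv j] is the local parameter 1/k_j at P_j (meaningful near P_j), [dval j]
   the value d_j prescribed at R_j, and [lam a b] the gluing constant, which is
   meaningful when a and b are identified. *)
Record ba_data (R : realType) (G : spectral_curve R) (n l : nat) := BaData {
  ngam : nat;
  dP : 'I_n -> normalization G;
  dQ : 'I_n -> normalization G;
  dR : 'I_l -> normalization G;
  dgam : 'I_ngam -> normalization G;
  kinv : 'I_n -> normalization G -> R[i];
  dval : 'I_l -> R[i];
  lam : normalization G -> normalization G -> R[i];
  ngamE : ngam%:Z = arithmetic_genus G + l%:Z - 1;
  data_uniq : uniq (codom dP ++ codom dQ ++ codom dR ++ codom dgam);
  data_nonsingular : forall x,
    x \in codom dP ++ codom dQ ++ codom dR ++ codom dgam -> ~~ is_node x;
  kinvP : forall j, local_parameter (kinv j) (dP j);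
  dval_neq0 : exists j, dval j != 0;
  lam_neq0 : forall a b, glued a b -> lam a b != 0;
  lamV : forall a b, glued a b -> lam b a = (lam a b)^-1 }.
Arguments dgam {R G n l} _ _.

Section Sections.
Variables (R : realType) (G : spectral_curve R) (n l : nat).
Variable B : ba_data G n l.
Local Notation X := (normalization G).

(* f is a function off P_1, ..., P_n, where it has essential singularities in
   general: its values at these points are unconstrained. *)
Definition baker_akhiezer (u : 'rV[R]_n) (f : X -> option R[i]) : Prop :=
  [/\ forall j, exists2 h : X -> R[i], holo_at h (dP B j) &
        \forall x \near (dP B j)^',
          omap (fun v => cexp (- ((kinv B j x)^-1 * (u ord0 j)%:C)) * v) (f x)
          = Some (h x),
      forall x, x \notin codom (dP B) ->
        regular_at f x \/ (x \in codom (dgam B) /\ has_order f x (-1)),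
      forall j, f (dR B j) = Some (dval B j) &
      forall a b, glued a b -> f a = omap (fun v => lam B a b * v) (f b)].

Fixpoint Ck_on (D : set 'rV[R]_n) (k : nat) (f : 'rV[R]_n -> R) : Prop :=
  {in D, continuous f} /\
  match k with
  | 0 => True
  | k'.+1 => forall i : 'I_n,
      (forall u, D u -> derivable f u (delta_mx ord0 i)) /\
      Ck_on D k' (fun u => 'D_(delta_mx ord0 i) f u)
  end.

Definition smooth_on (D : set 'rV[R]_n) (f : 'rV[R]_n -> R) : Prop :=
  forall k, Ck_on D k f.

(* Off P and gamma, psi has finite values, so [odflt] has no effect. *)
Definition unique_smooth_section (D : set 'rV[R]_n)
    (psi : 'rV[R]_n -> X -> option R[i]) : Prop :=
  [/\ forall u, D u -> baker_akhiezer u (psi u),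
      forall u f, D u -> baker_akhiezer u f ->
        forall x, x \notin codom (dP B) -> f x = psi u x &
      forall x, x \notin codom (dP B) ++ codom (dgam B) ->
        smooth_on D (fun u => complex.Re (odflt 0 (psi u x))) /\
        smooth_on D (fun u => complex.Im (odflt 0 (psi u x)))].

Definition holomorphic_involution (sigma : X -> X) : Prop :=
  [/\ curve_involution sigma,
      holomorphic_map sigma,
      forall j, sigma (dP B j) = dP B j,
      forall j, sigma (dQ B j) = dQ B j &
      forall j, \forall x \near dP B j,
        (kinv B j (sigma x))^-1 = - (kinv B j x)^-1].

(* P + gamma + sigma gamma and Q + R + sigma R, points being repeated
   according to multiplicity. *)
Definition zero_divisor (sigma : X -> X) : seq X :=
  codom (dP B) ++ codom (dgam B) ++ codom (sigma \o dgam B).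

Definition pole_divisor (sigma : X -> X) : seq X :=
  codom (dQ B) ++ codom (dR B) ++ codom (sigma \o dR B).

Definition admissible_form (sigma : X -> X) (W : one_form X) : Prop :=
  [/\ nonzero_meromorphic_form W,
      forall x k, form_order W x k ->
        Num.max k 0 = (count_mem x (zero_divisor sigma))%:Z,
      forall x k, form_order W x k ->
        (is_node x -> -1 <= k) /\
        (~~ is_node x ->
           Num.max (- k) 0 = (count_mem x (pole_divisor sigma))%:Z),
      forall a b, glued a b ->
        let ll := lam B a b * lam B (sigma a) (sigma b) in
        ll * residue W a + residue W b = 0 /\
        ll * residue W (sigma a) + residue W (sigma b) = 0 &
      forall j, residue W (dQ B j) = 1].

Definition antiholomorphic_involution (tau : X -> X) (W : one_form X) : Prop :=
  [/\ curve_involution tau /\ antiholomorphic_map tau,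
      (forall j, tau (dQ B j) = dQ B j) /\ (forall j, tau (dP B j) = dP B j),
      forall j, \forall x \near dP B j, kinv B j (tau x) = conjc (kinv B j x),
      antiholomorphic_pullback_is_conj tau W &
      perm_eq (codom (tau \o dgam B)) (codom (dgam B)) /\
      perm_eq (codom (tau \o dR B)) (codom (dR B))].

End Sections.

(* Main.v *)
(* If psi(u, .) satisfies the Baker-Akhiezer conditions, then so does its
   conjugate transform x |-> conj (psi(u, tau x)): conj \o f \o tau is
   holomorphic when f is and tau is antiholomorphic, and the invariance of P,
   gamma, R, of the parameters 1/k_j, of the d_j and of the gluing constants
   under tau and conjugation preserves each condition.  Uniqueness gives the
   reality condition, and Q_j is fixed by tau. *)
Require Import Defs.
From HB Require Import structures.
From mathcomp Require Import all_boot all_order all_algebra.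
From mathcomp Require Import complex.
From mathcomp Require Import all_classical all_reals all_analysis.

Set Implicit Arguments.
Unset Strict Implicit.
Unset Printing Implicit Defensive.

Import Order.TTheory GRing.Theory Num.Theory.
Import numFieldNormedType.Exports.
Local Open Scope classical_set_scope.
Local Open Scope ring_scope.
Local Open Scope complex_scope.

(** * Punctured neighbourhoods and one-variable holomorphy *)

(** Poles and essential singularities are described on punctured neighbourhoods; injectivity is what
    keeps [f y] away from [f x]. *)
Lemma cvg_dnbhs_inj (T U : topologicalType) (f : T -> U) (x : T) :
  {for x, continuous f} -> injective f -> f @ x^' --> (f x)^'.
Proof.
move=> cf fI A nA.
have : nbhs x (fun y => f y != f x -> A (f y)) := cf _ nA.
rewrite /= => {}nA.
apply: (@filterS _ (nbhs x) _ _ _ _ nA) => y fA yx; apply: fA.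
by rewrite (inj_eq fI).
Qed.

Lemma is_derive_comp (K : numFieldType) (f g : K -> K) (z a b : K) :
  is_derive (g z) 1 f a -> is_derive z 1 g b -> is_derive z 1 (f \o g) (a * b).
Proof.
move=> [/derivable1_diffP df <-] [/derivable1_diffP dg <-].
apply: DeriveDef; first exact/derivable1_diffP/differentiable_comp.
rewrite -!derive1E !derive1E' //; last exact: differentiable_comp.
rewrite diff_comp //= -[X in 'd f _ X]mulr1.
by rewrite [LHS]linearZ mulrC.
Qed.

Lemma isometry_continuous (K : numFieldType) (f : K -> K) :
  (forall x y, `|f x - f y| = `|x - y|) -> continuous f.
Proof.
move=> fK z; apply/(@cvgrPdist_lt K K _ _ (nbhs_filter z)) => e e0; near=> w.
by rewrite fK; near: w; apply: cvgr_dist_lt.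
Unshelve. all: by end_near. Qed.

Lemma near_eq_holo_near (K : numFieldType) (f g : K -> K) (z : K) :
  {near z, f =1 g} -> holo_near f z -> holo_near g z.
Proof.
(* Derivability at [w] requires equality on a whole neighbourhood of [w], not only at [w]. *)
move=> /near_join fg hf; near=> w.
by apply: (@near_eq_derivable _ _ _ f); near: w.
Unshelve. all: by end_near. Qed.

Lemma holo_near_comp (K : numFieldType) (f g : K -> K) (z : K) :
  holo_near g z -> holo_near f (g z) -> holo_near (f \o g) z.
Proof.
move=> hg hf.
have cg : {for z, continuous g}.
  exact/differentiable_continuous/derivable1_diffP/(nbhs_singleton hg).
near=> w.
apply/derivable1_diffP/differentiable_comp; apply/derivable1_diffP.
  by near: w.
by near: w; exact: (cg _ hf).
Unshelve. all: by end_near. Qed.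

(* Complex conjugation enters only as an isometric involutive automorphism of an
   abstract numFieldType K: this is where the definitions put the topology. *)
Section Conjugation.
Variables (K : numFieldType) (cj : {rmorphism K -> K}).
Hypotheses (cjK : involutive cj) (norm_cj : forall z, `|cj z| = `|z|).

Lemma conj_continuous : continuous cj.
Proof. by apply: isometry_continuous => x y; rewrite -rmorphB norm_cj. Qed.

(** The difference quotient at [z] with increment [h] is the conjugate of that of [f] at [cj z] with
    increment [cj h], and [cj h] tends to 0 through nonzero values. *)
Lemma is_derive_conj (f : K -> K) (z a : K) :
  is_derive (cj z) 1 f a -> is_derive z 1 (cj \o f \o cj) (cj a).
Proof.
move=> [df <-].
have cv : (fun h => h^-1 *: ((cj \o f \o cj) (h *: 1 + z) - (cj \o f \o cj) z))
    @ 0^' --> cj ('D_1 f (cj z)).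
  have -> : (fun h => h^-1 *: ((cj \o f \o cj) (h *: 1 + z) -
      (cj \o f \o cj) z)) =
    cj \o (fun h => h^-1 *: (f (h *: 1 + cj z) - f (cj z))) \o cj.
    apply/funext => h /=.
    rewrite -![_ *: _]/(_ * _) !rmorphM rmorphB rmorphD rmorphM rmorph1 /=.
    by rewrite fmorphV cjK.
  apply: (@cvg_comp _ _ _ cj _ _ 0^'); last first.
    exact: (continuous_cvg _ (@conj_continuous _) df).
  have := @cvg_dnbhs_inj _ _ cj 0 (@conj_continuous 0) (inv_inj cjK).
  by rewrite rmorph0.
apply: DeriveDef.
  by apply/cvg_ex; eexists; exact: cv.
exact: (cvg_lim _ cv).
Qed.

Lemma holo_near_conj (f : K -> K) (z : K) :
  holo_near f (cj z) -> holo_near (cj \o f \o cj) z.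
Proof.
move=> hf.
have : \forall w \near z, derivable f (cj w) 1 :=
  @conj_continuous z _ hf.
by apply: filterS => w dw; case: (is_derive_conj (derivableP dw)).
Qed.

(** For [cj] equal to [conjc] this is [antiholomorphic_map]. *)
Definition antiholo (X : charted K) (F : X -> X) : Prop :=
  forall (x : X) (c c' : chart K X), atlas c -> atlas c' ->
    cdom c x -> cdom c' (F x) ->
    (\forall w \near c x, cdom c' (F (cinv c w))) /\
    holo_near (cj \o c' \o F \o cinv c) (c x).

(** * Pullback along an antiholomorphic map of a Riemann surface *)

Section Surface.
Variables (X : charted K) (F : X -> X).
Hypotheses (XS : riemann_surface X) (hF : antiholo F).

(** The coordinate expression [G] is differentiable, hence continuous, and [F] is recovered from it
    near [x] by undoing the conjugation and the charts. *)
Lemma antiholo_continuous : continuous F.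
Proof.
move=> x; case: XS => _ cover charts _.
have [c ca cx] := cover x; have [c' ca' cx'] := cover (F x).
have [F_dom F_holo] := hF ca ca' cx cx'.
have [od _ invK c_cont _] := charts c ca.
have [_ _ invK' _ inv_cont'] := charts c' ca'.
set G := cj \o c' \o F \o cinv c in F_holo.
have G_cont : {for c x, continuous G}.
  exact/differentiable_continuous/derivable1_diffP/(nbhs_singleton F_holo).
have GE : \forall y \near x, cinv c' (cj (G (c y))) = F y.
  have dom : \forall y \near x, cdom c y by exact: open_nbhs_nbhs.
  have dom' : \forall y \near x, cdom c' (F (cinv c (c y))) :=
    c_cont _ cx _ F_dom.
  near=> y.
  have cy : cdom c y by near: y.
  have : cdom c' (F (cinv c (c y))) by near: y.
  by rewrite /G /= cjK invK// => ?; rewrite invK'.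
have cont : {for x, continuous (cinv c' \o cj \o G \o c)}.
  apply: continuous_comp; first exact: c_cont.
  apply: continuous_comp; first exact: G_cont.
  apply: continuous_comp; first exact: conj_continuous.
  by rewrite /G /= cjK invK//; exact: inv_cont'.
rewrite /continuous_at -[X in _ --> X](nbhs_singleton GE).
exact: cvg_trans (near_eq_cvg GE) cont.
Unshelve. all: by end_near. Qed.

Variables (f : X -> K) (x : X).
Hypothesis hf : holo_at f (F x).

(** Inserting [cj \o cj] and [cinv c' \o c'] splits the conjugate transform of [f] into two
    holomorphic functions of one variable. This holds only near [c x], as [cinv c'] inverts [c']
    only on [cdom c']. *)
Lemma antiholo_pullback_local (c c' : chart K X) :
  atlas c -> atlas c' -> cdom c x -> cdom c' (F x) ->
  {near c x, (cj \o (f \o cinv c') \o cj) \o (cj \o c' \o F \o cinv c) =1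
    (cj \o f \o F) \o cinv c}.
Proof.
move=> ca ca' cx cx'; have [F_dom _] := hF ca ca' cx cx'.
case: XS => _ _ charts _; have [_ _ invK' _ _] := charts c' ca'.
by apply: filterS F_dom => w wc' /=; rewrite cjK invK'.
Qed.

Lemma holo_at_antiholo : holo_at (cj \o f \o F) x.
Proof.
move=> c ca cx; case: (XS) => _ /(_ (F x))[c' ca' cx'] _ _.
apply: near_eq_holo_near (antiholo_pullback_local ca ca' cx cx') _.
have [_ F_holo] := hF ca ca' cx cx'.
apply: holo_near_comp => //; apply: holo_near_conj.
case: (XS) => _ _ /(_ c ca)[_ _ invK _ _] _.
by rewrite /= cjK invK//; exact: hf.
Qed.

(** Chain rule for the factorization in [antiholo_pullback_local]. *)
Lemma cderive_antiholo (c c' : chart K X) :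
  atlas c -> atlas c' -> cdom c x -> cdom c' (F x) ->
  cderive ((cj \o f \o F) \o cinv c) (c x) =
    cj (cderive (f \o cinv c') (c' (F x))) *
    cderive (cj \o c' \o F \o cinv c) (c x).
Proof.
move=> ca ca' cx cx'; have [_ F_holo] := hF ca ca' cx cx'.
case: (XS) => _ _ /(_ c ca)[_ _ invK _ _] _.
rewrite /cderive !derive1E.
rewrite -(near_eq_derive _ (antiholo_pullback_local ca ca' cx cx')).
have := derivableP (nbhs_singleton F_holo).
set G := cj \o c' \o F \o cinv c => dG.
have Gx : cj (G (c x)) = c' (F x) by rewrite /G /= cjK invK.
have := derivableP (nbhs_singleton (hf ca' cx')).
rewrite -Gx => /is_derive_conj df.
by have [_ ->] := is_derive_comp df dG.
Qed.

End Surface.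

Section Involution.
Variables (X : charted K) (F : X -> X).
Hypotheses (XS : riemann_surface X) (hF : antiholo F) (FK : involutive F).

Lemma local_parameter_antiholo (t : X -> K) (x : X) :
  local_parameter t (F x) -> local_parameter (cj \o t \o F) x.
Proof.
case=> t_holo t0 dt; split; first exact: holo_at_antiholo.
  by rewrite /= t0 rmorph0.
move=> c ca cx; case: (XS) => _ /(_ (F x))[c' ca' cx'] _ _.
apply/contraNneq: (dt c' ca' cx') => dt0.
(* As [t] is the transform of its own transform, a zero derivative of the transform at [x] would
   force one of [t] at [F x]. *)
have tE : t = cj \o (cj \o t \o F) \o F.
  by apply/funext => y /=; rewrite cjK FK.
rewrite tE (@cderive_antiholo _ _ XS hF _ _ _ c' c) ?FK//.
  by rewrite dt0 rmorph0 mul0r.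
exact: holo_at_antiholo.
Qed.

(** Conjugation is a field morphism, so it carries [t ^ k * g] to the same expression in the
    transforms of [t] and [g]. *)
Lemma has_order_antiholo (f : X -> option K) (x : X) (k : int) :
  has_order f (F x) k -> has_order (omap cj \o f \o F) x k.
Proof.
case=> t [g [tP g_holo gx0 fE fFx]].
exists (cj \o t \o F), (cj \o g \o F); split.
- exact: local_parameter_antiholo.
- exact: holo_at_antiholo.
- by rewrite /= fmorph_eq0.
- have FE := cvg_dnbhs_inj (@antiholo_continuous _ _ XS hF x) (inv_inj FK).
  have : \forall y \near x^', f (F y) = Some (t (F y) ^ k * g (F y)) := FE _ fE.
  by apply: filterS => y /= ->; rewrite /= rmorphM/= fmorphXz.
- by rewrite /= fFx; case: ifP => //= _; rewrite rmorphM/= fmorphXz.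
Qed.

Lemma regular_at_antiholo (f : X -> option K) (x : X) :
  regular_at f (F x) -> regular_at (omap cj \o f \o F) x.
Proof.
case=> g g_holo fE; exists (cj \o g \o F); first exact: holo_at_antiholo.
have : \forall y \near x, f (F y) = Some (g (F y)) :=
  @antiholo_continuous _ _ XS hF x _ fE.
by apply: filterS => y /= ->.
Qed.

End Involution.
End Conjugation.

(** * The disjoint sum of Riemann surfaces *)

Lemma sum_chartE (K : numFieldType) (m : nat) (X : 'I_m -> charted K)
    (j : 'I_m) (c : chart K (X j)) (x : X j) :
  sum_chart c (existT _ j x) = c x.
Proof. by rewrite /= (@untagE _ _ _ _ _ _ (existT _ j x) erefl). Qed.

Lemma disjoint_sum_riemann_surface (K : numFieldType) (m : nat)
    (X : 'I_m -> charted K) :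
  (forall j, riemann_surface (X j)) -> riemann_surface (disjoint_sum X).
Proof.
move=> XS; split.
- by apply: sigT_hausdorff => j; case: (XS j).
- move=> [j x]; case: (XS j) => _ /(_ x)[c ca cx] _ _.
  by exists (sum_chart c); [exists j, c | exists x].
- move=> _ [j [c [ca ->]]]; case: (XS j) => _ _ /(_ c ca)[od oi invK ct ict] _.
  split => [|||_ [x cx <-]|_ [x cx <-]].
  + exact: existT_open_map.
  + rewrite (_ : _ @` _ = c @` cdom c)//.
    rewrite [cdom _]/(existT _ j @` cdom c) image_comp.
    by apply: eq_imagel => x _; rewrite -sum_chartE.
  + by move=> _ [x cx <-]; rewrite sum_chartE /= invK.
  + rewrite /prop_for /continuous_at sum_chartE => A /(ct _ cx) nA.
    (* Neighbourhoods of [existT _ j x] in the sum are, by definition, the sets whose preimage in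
       component [j] is a neighbourhood of [x]. *)
    have : nbhs x (fun y => A (sum_chart c (existT _ j y))) by
      apply: (@filterS _ (nbhs x) _ _ _ _ nA) => y; rewrite /= -sum_chartE.
    by [].
  + rewrite sum_chartE; apply: continuous_comp; first exact: ict.
    exact: existT_continuous.
- move=> c c' x [j [c0 [ca0 ->]]] [j' [c0' [ca0' ->]]] [y cy <-] [y' cy' yy'].
  (* Charts sharing a point come from the same component; identifying the indices reduces to the
     transition maps there. *)
  case: (yy') => jj' _; move: c0' ca0' y' cy' yy'; rewrite jj'.
  move=> c0' ca0' y' cy' /eqP; rewrite eq_Tagged => /eqP yy'.
  rewrite {y'}[y']yy' in cy'.
  case: (XS j) => _ _ _ /(_ c0 c0' y ca0 ca0' cy cy').
  rewrite sum_chartE (_ : sum_chart c0' \o _ = c0' \o cinv c0)//.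
  by apply/funext => w; rewrite /comp sum_chartE.
Qed.

(** * The conjugate transform of a Baker-Akhiezer section *)

Lemma conjc_cexp (R : realType) (z : R[i]) : conjc (cexp z) = cexp (conjc z).
Proof.
case: z => a b; apply: etrans (rmorphM conjc _ _) _.
by congr (_ * _); [exact: conjc_real | rewrite /= cosN sinN].
Qed.

(** With [k] the value of [kinv B j] at [x] and [t] the real coordinate of [u], this turns the
    exponential factor at [tau x] into the one at [x]. *)
Lemma conjc_cexp_mul (R : realType) (k v : R[i]) (t : R) :
  conjc (cexp (- ((conjc k)^-1 * t%:C)) * v) =
  cexp (- (k^-1 * t%:C)) * conjc v.
Proof.
apply: etrans (rmorphM conjc _ _) _; congr (_ * _).
apply: etrans (conjc_cexp _) _; congr cexp.
apply: etrans (rmorphN conjc _) _; congr (- _).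
apply: etrans (rmorphM conjc _ _) _; congr (_ * _); last exact: conjc_real.
by apply: etrans (fmorphV conjc _) _; rewrite /= conjcK.
Qed.

Section RealStructure.
Variables (R : realType) (G : spectral_curve R) (n l : nat).
Variables (B : ba_data G n l) (tau : normalization G -> normalization G).
Hypotheses (tauK : involutive tau) (tau_anti : antiholomorphic_map tau)
  (tau_glued : forall a b, glued a b -> glued (tau a) (tau b))
  (tau_P : forall j, tau (dP B j) = dP B j)
  (tau_kinv : forall j, \forall x \near dP B j,
     kinv B j (tau x) = conjc (kinv B j x))
  (tau_gam : perm_eq (codom (tau \o dgam B)) (codom (dgam B)))
  (tau_R : perm_eq (codom (tau \o dR B)) (codom (dR B)))
  (tau_dval : forall j j' : 'I_l,
     tau (dR B j) = dR B j' -> conjc (dval B j) = dval B j')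
  (tau_lam : forall a b,
     glued a b -> conjc (lam B a b) = lam B (tau a) (tau b)).

Lemma normalization_riemann_surface : riemann_surface (normalization G).
Proof.
by apply: disjoint_sum_riemann_surface => j; case: (componentP (s:=G) j).
Qed.

Lemma baker_akhiezer_conj (u : 'rV[R]_n) (f : normalization G -> option R[i]) :
  baker_akhiezer B u f -> baker_akhiezer B u (omap conjc \o f \o tau).
Proof.
case=> f_P f_reg f_R f_glued.
have XS := normalization_riemann_surface.
have norm_conjc (z : R[i]) : `|conjc z| = `|z| := normcJ z.
have tau_cont :=
  @antiholo_continuous _ conjc (@conjcK R) norm_conjc _ _ XS tau_anti.
split.
- move=> j; have [h h_holo hE] := f_P j.
  exists (conjc \o h \o tau).
    apply: (@holo_at_antiholo _ conjc (@conjcK R) norm_conjc _ _ XS tau_anti).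
    by rewrite tau_P.
  have := cvg_dnbhs_inj (tau_cont (dP B j)) (inv_inj tauK).
  rewrite tau_P => /(_ _ hE) {}hE.
  have {}hE : \forall x \near (dP B j)^',
      omap (fun v => cexp (- ((kinv B j (tau x))^-1 * (u ord0 j)%:C)) * v)
        (f (tau x)) = Some (h (tau x)) := hE.
  have kE := nbhs_dnbhs (tau_kinv j).
  near=> x.
  have : omap (fun v => cexp (- ((kinv B j (tau x))^-1 * (u ord0 j)%:C)) * v)
      (f (tau x)) = Some (h (tau x)) by near: x.
  have -> : kinv B j (tau x) = conjc (kinv B j x) by near: x.
  (* The value [None] is excluded, since the regularized value is [Some (h (tau x))]. *)
  rewrite /=; case: (f _) => //= v [] <-; congr Some.
  exact/esym/conjc_cexp_mul.
- move=> x xP; have txP : tau x \notin codom (dP B).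
    apply: contra xP => /codomP[j txE]; apply/codomP; exists j.
    by rewrite -tau_P -txE tauK.
  have [f_regx|[xgam f_pole]] := f_reg _ txP.
    left; exact:
      (@regular_at_antiholo _ conjc (@conjcK R) norm_conjc _ _ XS tau_anti).
  (* The pole of [f] at [tau x] lies in gamma, which is [tau]-invariant, so [x] lies in gamma
     too. *)
  right; split; last first.
    exact:
      (@has_order_antiholo _ conjc (@conjcK R) norm_conjc _ _ XS tau_anti).
  rewrite -(perm_mem tau_gam); have /codomP[i xE] := xgam.
  by apply/codomP; exists i; rewrite /= -xE tauK.
- move=> j; have : tau (dR B j) \in codom (dR B).
    by rewrite -(perm_mem tau_R); apply/codomP; exists j.
  move=> /codomP[j' tE].
  by rewrite /= tE f_R /= -(tau_dval tE) conjcK.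
(* The gluing constant at the image node is the conjugate of [lam B a b], and the outer conjugation
   restores it. *)
- move=> a b ab; rewrite /= (f_glued _ _ (tau_glued ab)) -tau_lam//.
  by case: (f (tau b)) => //= v; rewrite rmorphM/= conjcK.
Unshelve. all: by end_near. Qed.

End RealStructure.

Theorem theorem2 (R : realType) (G : spectral_curve R) (n l : nat)
  (B : ba_data G n l)
  (D : set 'rV[R]_n) (D_open : open D) (D_connected : connected D)
  (D_nonempty : D !=set0)
  (psi : 'rV[R]_n -> normalization G -> option R[i])
  (psiP : unique_smooth_section B D psi)
  (sigma : normalization G -> normalization G)
  (sigmaP : holomorphic_involution B sigma)
  (W : one_form (normalization G)) (WP : admissible_form B sigma W)
  (tau : normalization G -> normalization G)
  (tauP : antiholomorphic_involution B tau W)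
  (d_tau : forall j j' : 'I_l,
     tau (dR B j) = dR B j' -> conjc (dval B j) = dval B j')
  (lam_tau : forall a b : normalization G, glued a b ->
     conjc (lam B a b) = lam B (tau a) (tau b)) :
  (forall (u : 'rV[R]_n) (x : normalization G), D u -> x \notin codom (dP B) ->
     psi u x = omap conjc (psi u (tau x))) /\
  (forall (u : 'rV[R]_n) (j : 'I_n), D u ->
     exists r : R, psi u (dQ B j) = Some r%:C).
Proof.
case: tauP => -[[tauK _ tau_glued] tau_anti] [tau_Q tau_P] tau_kinv _
  [tau_gam tau_R].
case: psiP => psi_ba psi_uniq _.
have real u x : D u -> x \notin codom (dP B) ->
    psi u x = omap conjc (psi u (tau x)).
  move=> Du xP; rewrite -(psi_uniq u (omap conjc \o psi u \o tau))//.
  exact: baker_akhiezer_conj (psi_ba u Du).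
split=> // u j Du.
(* Away from P and gamma the section is regular, so its value at [dQ B j] is finite. *)
have [QP Qgam] : dQ B j \notin codom (dP B) /\ dQ B j \notin codom (dgam B).
  have := data_uniq B; rewrite !cat_uniq !has_cat !negb_or.
  case/and3P => _ /andP[/hasPn PQ _] /and3P[_ /andP[_ /hasPn Qgam] _].
  have QQ : dQ B j \in codom (dQ B) by exact: codom_f.
  by split; [exact: PQ | apply/negP => /Qgam; rewrite QQ].
have [_ psi_reg _ _] := psi_ba u Du.
have [[g _ psiE]|[]] := psi_reg _ QP; last by rewrite (negPf Qgam).
have {}psiE := nbhs_singleton psiE.
have := real u _ Du QP; rewrite tau_Q psiE /= => -[gE].
exists (complex.Re (g (dQ B j))); congr Some.
(* A value fixed by conjugation has imaginary part equal to its opposite, hence zero. *)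
by case: (g _) gE => a b [] /esym/eqP; rewrite eqNr => /eqP ->.
Qed.
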